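(* Let $\mathcal{S}$ be the class of simple combinatorial auctions defined in the context. For every auction in $\mathcal{S}$, the pure liquid price of anarchy over games in which all players have (monotone) subadditive valuation functions is at most $2$. That is, for every number of players $n$, every number of items $m$, all monotone subadditive valuation functions $v_1,\dots,v_n$, all budgets $c_1,\dots,c_n\ge 0$, every pure Nash equilibrium bid matrix $\mathbf{b}$ of the induced game (with conservative players), and every allocation $\mathbf{Y}$ of the items, $\mathrm{LW}(\mathbf{Y}) \le 2\,\mathrm{LW}(\mathbf{X}(\mathbf{b}))$.
   Context: Setting: $m$ items are allocated to $n$ players. Player $i$ has a valuation function $v_i:2^{[m]}\to\mathbb{R}_{\ge 0}$ and a private budget $c_i\in\mathbb{R}_{\ge 0}$. A valuation $v_i$ is monotone if $S\subseteq T$ implies $v_i(S)\le v_i(T)$, and subadditive if $v_i(S\cup T)\le v_i(S)+v_i(T)$ for all $S,T\subseteq[m]$. All valuations are assumed monotone and subadditive. Class $\mathcal{S}$: each player $i$ submits bids $\mathbf{b}_i=(b_{ij})_{j\in[m]}$, $b_{ij}\ge 0$; $\mathbf{b}=(\mathbf{b}_i)_{i\in[n]}$ and $\mathbf{b}_{[j]}=(b_{ij})_{i\in[n]}$. An auction in $\mathcal{S}$ allocates each item $j$ independently to a player $\pi(j)$ with the highest bid for it ($b_{\pi(j),j}\ge b_{ij}$ for all $i$; ties are broken arbitrarily), and charges $\pi(j)$ a payment $p_j(\mathbf{b}_{[j]})\in[0,b_{\pi(j),j}]$, where $p_j$ is non-decreasing and continuous in every bid. $\mathbf{X}(\mathbf{b})=(X_1,\dots,X_n)$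 denotes the resulting allocation, a partition of $[m]$. Utility: $u_i(\mathbf{b})=v_i(X_i)-\sum_{j\in X_i}p_j(\mathbf{b}_{[j]})$ if player $i$'s total payment does not exceed $c_i$, and $-\infty$ otherwise. A bid matrix $\mathbf{b}$ is a pure Nash equilibrium if $u_i(\mathbf{b})\ge u_i(\mathbf{y},\mathbf{b}_{-i})$ for every player $i$ and every bid vector $\mathbf{y}$, where $(\mathbf{y},\mathbf{b}_{-i})$ is $\mathbf{b}$ with $\mathbf{b}_i$ replaced by $\mathbf{y}$. $\mathrm{EQ}(\mathcal{G})$ is the set of equilibria of the game $\mathcal{G}$. Conservative behavior (standing assumption): the sum of bids a player submits for a bundle of items exceeds neither her value for this bundle nor her budget, that is, $\sum_{j\in X_i}b_{ij}\le\min\{v_i(X_i),c_i\}$. Liquid welfare: for an allocation $\mathbf{X}$ (a partition of $[m]$ among the players), $\mathrm{LW}(\mathbf{X})=\sum_{i\in[n]}\min\{v_i(X_i),c_i\}$. The pure liquid price of anarchy of an auction is $\mathrm{LPoA}=\sup_{\mathcal{G}}\frac{\max_{\mathbf{Y}}\mathrm{LW}(\mathbf{Y})}{\min_{\mathbf{b}\in\mathrm{EQ}(\mathcal{G})}\mathrm{LW}(\mathbf{X}(\mathbf{b}))}$, the supremum being over all games induced by the auction. *)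

(* Defs.v *)
From HB Require Import structures.
From mathcomp Require Import all_boot all_order all_algebra.
From mathcomp Require Import all_classical all_reals all_analysis.
Import Order.TTheory GRing.Theory Num.Theory.
Import numFieldNormedType.Exports.

Set Implicit Arguments.
Unset Strict Implicit.
Unset Printing Implicit Defensive.

Local Open Scope ring_scope.

(* A bid matrix is b : 'M[R]_(n, m): the bid vector of player i is row i b,
   and the vector of the bids on item j is col j b. *)

Definition nonneg_mx (R : realType) (p q : nat) (A : 'M[R]_(p, q)) : Prop :=
  forall i j, 0 <= A i j.

Definition set_bid (R : realType) (n : nat) (x : 'cV[R]_n) (i : 'I_n) (t : R) :
  'cV[R]_n := \col_k (if k == i then t else x k 0).

Definition deviate (R : realType) (n m : nat) (b : 'M[R]_(n, m)) (i : 'I_n)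
  (y : 'rV[R]_m) : 'M[R]_(n, m) :=
  \matrix_(k, j) (if k == i then y 0 j else b k j).

(* The class S. Both the winner of an item (hence the way ties are broken) and
   the payment for it are functions of the bids on that item only; the rules may
   differ from item to item. Negative bids are outside the model, so nothing is
   required of the rules there, and continuity is relative to [0, +oo). *)
Record simple_auction (R : realType) (n m : nat) := SimpleAuction {
  winner : 'I_m -> 'cV[R]_n -> 'I_n ;
  payment : 'I_m -> 'cV[R]_n -> R ;
  winner_highest : forall (j : 'I_m) (x : 'cV[R]_n), nonneg_mx x ->
    forall i, x i 0 <= x (winner j x) 0 ;
  payment_ge0 : forall (j : 'I_m) (x : 'cV[R]_n), nonneg_mx x ->
    0 <= payment j x ;
  payment_le_bid : forall (j : 'I_m) (x : 'cV[R]_n), nonneg_mx x ->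
    payment j x <= x (winner j x) 0 ;
  payment_nondecreasing : forall (j : 'I_m) (x : 'cV[R]_n) (i : 'I_n),
    nonneg_mx x -> forall s t : R, 0 <= s -> s <= t ->
    payment j (set_bid x i s) <= payment j (set_bid x i t) ;
  payment_continuous : forall (j : 'I_m) (x : 'cV[R]_n) (i : 'I_n),
    nonneg_mx x ->
    {within [set` `[0, +oo[], continuous (fun t : R => payment j (set_bid x i t))}%classic
}.

Record game (R : realType) (n m : nat) := Game {
  value : 'I_n -> {set 'I_m} -> R ;
  budget : 'I_n -> R
}.

Definition monotone_valuation (R : realType) (m : nat) (v : {set 'I_m} -> R) :
  Prop := forall S T : {set 'I_m}, S \subset T -> v S <= v T.

Definition subadditive_valuation (R : realType) (m : nat)
  (v : {set 'I_m} -> R) : Prop :=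
  forall S T : {set 'I_m}, v (S :|: T) <= v S + v T.

Definition subadditive_game (R : realType) (n m : nat) (G : game R n m) : Prop :=
  (forall i, [/\ forall S, 0 <= value G i S,
                 monotone_valuation (value G i) &
                 subadditive_valuation (value G i)])
  /\ (forall i, 0 <= budget G i).

Section Outcome.
Context (R : realType) (n m : nat).

(* The library's notion of partition of a set cannot be used here, because it
   excludes empty blocks. *)
Definition is_allocation (X : {ffun 'I_n -> {set 'I_m}}) : bool :=
  [forall i, forall k, (i != k) ==> [disjoint X i & X k]]
  && (\bigcup_i X i == [set: 'I_m]%SET)%SET.

Definition liquid_welfare (G : game R n m) (X : {ffun 'I_n -> {set 'I_m}}) : R :=
  \sum_(i < n) Num.min (value G i (X i)) (budget G i).

Definition allocation (A : simple_auction R n m) (b : 'M[R]_(n, m)) :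
  {ffun 'I_n -> {set 'I_m}} :=
  [ffun i => [set j | winner A j (col j b) == i]%SET].

Definition total_payment (A : simple_auction R n m) (b : 'M[R]_(n, m))
  (i : 'I_n) : R :=
  \sum_(j in allocation A b i) payment A j (col j b).

Definition utility (A : simple_auction R n m) (G : game R n m)
  (b : 'M[R]_(n, m)) (i : 'I_n) : \bar R :=
  if total_payment A b i <= budget G i
  then (value G i (allocation A b i) - total_payment A b i)%:E
  else -oo%E.

Definition pure_nash (A : simple_auction R n m) (G : game R n m)
  (b : 'M[R]_(n, m)) : Prop :=
  forall (i : 'I_n) (y : 'rV[R]_m), nonneg_mx y ->
  (utility A G (deviate b i y) i <= utility A G b i)%E.

Definition conservative (A : simple_auction R n m) (G : game R n m)
  (b : 'M[R]_(n, m)) : Prop :=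
  forall i : 'I_n, \sum_(j in allocation A b i) b i j
    <= Num.min (value G i (allocation A b i)) (budget G i).

(* Conservativeness is a condition on the equilibrium profile only; deviations
   range over all nonnegative bid vectors. *)
Definition equilibria (A : simple_auction R n m) (G : game R n m) :
  set 'M[R]_(n, m) :=
  [set b | [/\ nonneg_mx b, conservative A G b & pure_nash A G b]]%classic.

(* The default value 0 is harmless: liquid welfare is nonnegative. *)
Definition optimal_welfare (G : game R n m) : R :=
  \big[Num.max/0]_(X | is_allocation X) liquid_welfare G X.

(* The infimum of a nonempty set of equilibrium welfares is a minimum: there are
   finitely many allocations. *)
Definition worst_equilibrium_welfare (A : simple_auction R n m)
  (G : game R n m) : \bar R :=
  ereal_inf [set (liquid_welfare G (allocation A b))%:E
            | b in equilibria A G]%classic.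

(* Liquid price of anarchy over the games in C that have an equilibrium. In
   \bar R, x / 0 = +oo for x > 0, whereas 0 / 0 = 0. *)
Definition LPoA (A : simple_auction R n m) (C : set (game R n m)) : \bar R :=
  ereal_sup [set ((optimal_welfare G)%:E / worst_equilibrium_welfare A G)%E
            | G in [set G | C G /\ (equilibria A G !=set0)%classic]]%classic.

End Outcome.

(* Main.v *)
(* Fix an equilibrium b with allocation X, and write B(S) for the sum over the
   items of S of the highest bids. If B(Y_i) >= c_i, then
   min(v_i(Y_i), c_i) <= B(Y_i). Otherwise player i can afford to outbid
   everybody slightly on Y_i, bidding 0 elsewhere, so that the equilibrium
   condition gives v_i(Y_i) <= v_i(X_i) + B(Y_i). In both cases
   min(v_i(Y_i), c_i) <= min(v_i(X_i), c_i) + B(Y_i). Summing over i gives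
   LW(Y) <= LW(X) + B([m]), and B([m]) <= LW(X) by conservativeness. *)
Require Import Defs.
From mathcomp Require Import all_boot all_order all_algebra.
From mathcomp Require Import all_classical all_reals all_analysis.
Import Order.TTheory GRing.Theory Num.Theory.

Set Implicit Arguments.
Unset Strict Implicit.
Unset Printing Implicit Defensive.

Local Open Scope ring_scope.

(** Taken as the winner's own bid rather than as a maximum, so that over a player's bundle it sums
    to exactly the quantity that [conservative] bounds. *)
Definition highest_bid (R : realType) (n m : nat) (A : simple_auction R n m)
  (b : 'M[R]_(n, m)) (j : 'I_m) : R := b (winner A j (col j b)) j.

Lemma sum_allocation (R : realType) (n m : nat)
    (X : {ffun 'I_n -> {set 'I_m}}) (F : 'I_m -> R) : is_allocation X ->
  \sum_i \sum_(j in X i) F j = \sum_j F j.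
Proof.
case/andP=> /forallP dX /eqP covX.
rewrite (exchange_big_dep predT) //=.
apply: eq_bigr => j _.
have /bigcupP[i _ jXi] : j \in (\bigcup_i X i)%SET by rewrite covX inE.
rewrite (big_pred1 i) // => k /=.
apply/idP/eqP => [jXk|-> //]; apply/eqP/contraT => ki.
have /implyP/(_ ki) := forallP (dX k) i.
by move=> /disjointFr/(_ jXk); rewrite jXi.
Qed.

Section Auction.
Context (R : realType) (n m : nat) (A : simple_auction R n m).
Implicit Types (b : 'M[R]_(n, m)) (y : 'rV[R]_m) (G : game R n m).

Lemma nonneg_col b (j : 'I_m) : nonneg_mx b -> nonneg_mx (col j b).
Proof. by move=> b0 i k; rewrite mxE. Qed.

Lemma nonneg_deviate b (i : 'I_n) y :
  nonneg_mx b -> nonneg_mx y -> nonneg_mx (deviate b i y).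
Proof. by move=> b0 y0 k j; rewrite mxE; case: ifP. Qed.

Lemma is_allocation_allocation b : is_allocation (allocation A b).
Proof.
apply/andP; split.
  apply/forallP => i; apply/forallP => k; apply/implyP => ik.
  rewrite -setI_eq0; apply/eqP/setP => j; rewrite !ffunE !inE.
  by apply/negP => /andP[/eqP-> /eqP]; apply/eqP.
apply/eqP/setP => j; rewrite inE; apply/bigcupP.
by exists (winner A j (col j b)); rewrite // ffunE inE.
Qed.

Lemma highest_bid_ge0 b (j : 'I_m) : nonneg_mx b -> 0 <= highest_bid A b j.
Proof. by move=> b0; apply: b0. Qed.

Lemma bid_le_highest b (i : 'I_n) (j : 'I_m) :
  nonneg_mx b -> b i j <= highest_bid A b j.
Proof.
by move=> b0; have := winner_highest A j (nonneg_col j b0) i; rewrite !mxE.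
Qed.

Lemma total_payment_ge0 b (i : 'I_n) : nonneg_mx b -> 0 <= total_payment A b i.
Proof.
by move=> b0; apply: sumr_ge0 => j _; apply/payment_ge0/nonneg_col.
Qed.

Lemma total_payment_le_bids b (i : 'I_n) : nonneg_mx b ->
  total_payment A b i <= \sum_(j in allocation A b i) b i j.
Proof.
move=> b0; apply: ler_sum => j; rewrite ffunE inE => /eqP wj.
by have := payment_le_bid A j (nonneg_col j b0); rewrite wj mxE.
Qed.

(** Any other winner would still hold her old bid, at most the old highest one and so below [y 0 j].
    The strict inequality makes the tie-breaking rule irrelevant. *)
Lemma deviate_wins b (i : 'I_n) y (j : 'I_m) :
  nonneg_mx b -> nonneg_mx y -> highest_bid A b j < y 0 j ->
  j \in allocation A (deviate b i y) i.
Proof.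
move=> b0 y0 lt_y; rewrite ffunE inE.
have := bid_le_highest i j (nonneg_deviate i b0 y0).
rewrite /highest_bid !mxE eqxx; case: ifP => // _ le_y.
by have := lt_le_trans lt_y (le_trans le_y (bid_le_highest _ _ b0)); rewrite ltxx.
Qed.

Lemma nash_outbid G b (i : 'I_n) (S : {set 'I_m}) (q : 'I_m -> R) :
  subadditive_game G -> nonneg_mx b -> pure_nash A G b ->
  (forall j, j \in S -> highest_bid A b j < q j) ->
  \sum_(j in S) q j <= budget G i ->
  value G i S <= value G i (allocation A b i) + \sum_(j in S) q j.
Proof.
move=> [/(_ i)[_ vmono _] _] b0 nash lt_q le_c.
pose y : 'rV[R]_m := \row_j (if j \in S then q j else 0).
have y0 : nonneg_mx y.
  move=> k j; rewrite mxE; case: ifP => // jS.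
  exact: le_trans (highest_bid_ge0 j b0) (ltW (lt_q j jS)).
(* Only an inclusion: ties at bid 0 may give player [i] further items. Monotonicity absorbs their
   value, and they cost nothing because payments never exceed bids. *)
have sub : S \subset allocation A (deviate b i y) i.
  by apply/fintype.subsetP => j jS; apply: deviate_wins => //; rewrite mxE jS lt_q.
have pay : total_payment A (deviate b i y) i <= \sum_(j in S) q j.
  apply: le_trans (total_payment_le_bids i (nonneg_deviate i b0 y0)) _.
  rewrite big_mkcond [leRHS]big_mkcond; apply: ler_sum => j _.
  rewrite !mxE eqxx; case: (boolP (j \in S)) => [/(fintype.subsetP sub)->//|_].
  by case: ifP.
have := nash i y y0; rewrite /utility (le_trans pay le_c).
(* An equilibrium payment above the budget would give utility [-oo], less than the finite utility of
   the deviation. *)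
case: ifP => // _; rewrite lee_fin => le_u.
have le_v := vmono _ _ sub.
have p0 := total_payment_ge0 i b0.
rewrite -lerBlDr; apply: le_trans (le_trans le_u _); last by rewrite gerBl.
exact: lerB.
Qed.

Lemma nash_min_value G b (i : 'I_n) (S : {set 'I_m}) :
  subadditive_game G -> nonneg_mx b -> pure_nash A G b ->
  Num.min (value G i S) (budget G i) <=
  Num.min (value G i (allocation A b i)) (budget G i)
    + \sum_(j in S) highest_bid A b j.
Proof.
move=> sG b0 nash; set B := \sum_(j in S) _.
have B0 : 0 <= B by apply: sumr_ge0 => j _; apply: highest_bid_ge0.
have [vG c0] := sG; have [v0 _ _] := vG i.
have [le_cB|lt_Bc] := leP (budget G i) B.
  rewrite ge_min (le_trans le_cB) ?orbT // lerDr.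
  by rewrite le_min v0 c0.
(* The bound is the minimum of [value + B] and [budget + B]; the second is immediate. The first is
   proved up to an arbitrary slack [d]. *)
rewrite addr_minl le_min; apply/andP; split; last first.
  by rewrite ge_min lerDl B0 orbT.
rewrite ge_min; apply/orP; left; apply/ler_addgt0Pr => d d0.
(* The total overbid [d'] must fit both the slack and the money left after paying [B]. *)
pose d' := Num.min d (budget G i - B).
have d'0 : 0 < d' by rewrite lt_min d0 subr_gt0.
(* Since [S] has at most [m] items, the increments total at most [d']; the successor avoids division
   by zero when [m = 0]. *)
pose e := d' / m.+1%:R.
have e0 : 0 < e by rewrite divr_gt0.
pose q j := highest_bid A b j + e.
have le_q : \sum_(j in S) q j <= B + d'.
  rewrite big_split lerD2l /= sumr_const -mulr_natl /e mulrCA.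
  rewrite ler_piMr ?(ltW d'0) // ler_pdivrMr ?ltr0Sn // mul1r ler_nat.
  by rewrite (leq_trans (max_card _)) // card_ord.
have le_qc : \sum_(j in S) q j <= budget G i.
  by rewrite (le_trans le_q) // -lerBrDl ge_min lexx orbT.
have lt_q j : j \in S -> highest_bid A b j < q j by rewrite ltrDl.
apply: le_trans (nash_outbid sG b0 nash lt_q le_qc) _.
rewrite -addrA lerD2l (le_trans le_q) // lerD2l.
by rewrite ge_min lexx.
Qed.

(** Grouping the items by winner turns the sum into the winners' own bids on their bundles. *)
Lemma sum_highest_bid_le G b :
  conservative A G b ->
  \sum_j highest_bid A b j <= liquid_welfare G (allocation A b).
Proof.
move=> cons; rewrite -(sum_allocation _ (is_allocation_allocation b)).
apply: ler_sum => i _; apply: le_trans (cons i).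
by apply: ler_sum => j; rewrite ffunE inE /highest_bid => /eqP->.
Qed.

Lemma equilibrium_welfare G b (Y : {ffun 'I_n -> {set 'I_m}}) :
  subadditive_game G -> equilibria A G b -> is_allocation Y ->
  liquid_welfare G Y <= 2 * liquid_welfare G (allocation A b).
Proof.
move=> sG [b0 cons nash] aY; rewrite mulr_natl mulr2n.
apply: le_trans (lerD (lexx _) (sum_highest_bid_le cons)).
rewrite -(sum_allocation _ aY) -big_split /=.
by apply: ler_sum => i _; apply: nash_min_value.
Qed.

Lemma liquid_welfare_ge0 G (X : {ffun 'I_n -> {set 'I_m}}) :
  subadditive_game G -> 0 <= liquid_welfare G X.
Proof.
by move=> [vG c0]; apply: sumr_ge0 => i _; rewrite le_min c0; case: (vG i) => ->.
Qed.

Lemma optimal_welfare_le G b :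
  subadditive_game G -> equilibria A G b ->
  optimal_welfare G <= 2 * liquid_welfare G (allocation A b).
Proof.
move=> sG eb; apply: bigmax_le => [|Y aY]; last exact: equilibrium_welfare.
by rewrite mulr_ge0 // liquid_welfare_ge0.
Qed.

Lemma optimal_welfare_ge0 G : 0 <= optimal_welfare G.
Proof. exact: bigmax_ge_id. Qed.

Lemma worst_equilibrium_ratio_le G :
  subadditive_game G -> (equilibria A G !=set0)%classic ->
  ((optimal_welfare G)%:E / worst_equilibrium_welfare A G <= 2%:E)%E.
Proof.
move=> sG [b eb].
have ge_opt : ((optimal_welfare G / 2)%:E <= worst_equilibrium_welfare A G)%E.
  apply: le_ereal_inf_tmp => _ [b' eb' <-].
  by rewrite lee_fin ler_pdivrMr // mulrC optimal_welfare_le.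
(* The given equilibrium rules out the infimum [+oo]; the lower bound above rules out [-oo]. *)
have : (worst_equilibrium_welfare A G
        <= (liquid_welfare G (allocation A b))%:E)%E.
  by apply: ereal_inf_lbound; exists b.
move: ge_opt; case: worst_equilibrium_welfare => [w| |] //.
rewrite lee_fin => ge_opt _.
have opt0 := optimal_welfare_ge0 G.
have : 0 <= w by apply: le_trans ge_opt; rewrite divr_ge0.
(* If [w = 0], its inverse is [+oo], but the optimum vanishes too and the product is 0. *)
rewrite le_eqVlt => /predU1P[w0|w0].
  have -> : optimal_welfare G = 0.
    apply/le_anti; rewrite opt0 andbT.
    by move: ge_opt; rewrite -w0 ler_pdivrMr // mul0r.
  by rewrite mul0e lee_fin.
rewrite inver gt_eqF // -EFinM lee_fin ler_pdivrMr //.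
by rewrite mulrC -ler_pdivrMr.
Qed.

End Auction.

Theorem theorem2 (R : realType) (n m : nat) (A : simple_auction R n m) :
  (LPoA A (@subadditive_game R n m) <= 2%:E)%E /\
  (forall (G : game R n m) (b : 'M[R]_(n, m)) (Y : {ffun 'I_n -> {set 'I_m}}),
     subadditive_game G -> equilibria A G b -> is_allocation Y ->
     liquid_welfare G Y <= 2 * liquid_welfare G (allocation A b)).
Proof.
split; last by move=> G b Y; apply: equilibrium_welfare.
apply: ge_ereal_sup => _ [G [sG eG] <-].
exact: worst_equilibrium_ratio_le.
Qed.
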